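(* Let $d\ge 2$, and let $\Lambda$ and $\Lambda'$ be random variables with values in $[0,1]$ and $E(\Lambda)=E(\Lambda')=1/2$. Let $(I_1,\dots,I_d)$ and $(I_1',\dots,I_d')$ be the random vectors in $\{0,1\}^d$ whose probability mass functions are constructed as Bernoulli mixtures with respective mixing random variables $\Lambda$ and $\Lambda'$, i.e. $$\Pr(I_1=i_1,\dots,I_d=i_d)=\int_0^1\lambda^{i_\bullet}(1-\lambda)^{d-i_\bullet}\,\mathrm{d}F_\Lambda(\lambda),\qquad (i_1,\dots,i_d)\in\{0,1\}^d,\quad i_\bullet=\sum_{j=1}^d i_j,$$ and similarly for $(I_1',\dots,I_d')$ with $F_{\Lambda'}$. Let $(U_1,\dots,U_d)$ and $(U_1',\dots,U_d')$ be random vectors whose cumulative distribution functions are the FGM copulas associated to $(I_1,\dots,I_d)$ and $(I_1',\dots,I_d')$ respectively. If $\Lambda\preceq_{cx}\Lambda'$, then $$(I_1,\dots,I_d)\preceq_{sm}(I_1',\dots,I_d')\quad\text{and}\quad (U_1,\dots,U_d)\preceq_{sm}(U_1',\dots,U_d').$$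
   Context: $F_\Lambda$ denotes the cumulative distribution function of $\Lambda$. FGM copula associated to a Bernoulli vector: for a random vector $(I_1,\dots,I_d)$ in $\{0,1\}^d$ with $\Pr(I_j=1)=1/2$ for all $j$ and probability mass function $f_{I_1,\dots,I_d}$, it is $$C(u_1,\dots,u_d)=\sum_{(i_1,\dots,i_d)\in\{0,1\}^d} f_{I_1,\dots,I_d}(i_1,\dots,i_d)\prod_{m=1}^d u_m\left(1+(-1)^{i_m}(1-u_m)\right),\quad (u_1,\dots,u_d)\in[0,1]^d.$$ Convex order: for random variables $X,X'$ with finite means, $X\preceq_{cx}X'$ if $E\{\varphi(X)\}\le E\{\varphi(X')\}$ for all real convex functions $\varphi$ such that the expectations exist. Supermodular order: $(V_1,\dots,V_d)\preceq_{sm}(V_1',\dots,V_d')$ if $E\{\phi(V_1,\dots,V_d)\}\le E\{\phi(V_1',\dots,V_d')\}$ for all supermodular functions $\phi:\mathbb{R}^d\to\mathbb{R}$ such that the expectations exist. Here $\phi$ is supermodular if $$\phi(x_1,\dots,x_i+\varepsilon,\dots,x_j+\delta,\dots,x_d)-\phi(x_1,\dots,x_i+\varepsilon,\dots,x_j,\dots,x_d)\ge \phi(x_1,\dots,x_i,\dots,x_j+\delta,\dots,x_d)-\phi(x_1,\dots,x_i,\dots,x_j,\dots,x_d)$$ for all $(x_1,\dots,x_d)\in\mathbb{R}^d$, $1\le i<j\le d$ and all $\varepsilon,\delta>0$. *)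

(* Defs.v *)
From HB Require Import structures.
From mathcomp Require Import all_boot all_order all_algebra.
From mathcomp Require Import all_classical all_reals all_analysis.

Set Implicit Arguments.
Unset Strict Implicit.
Unset Printing Implicit Defensive.

Import Order.TTheory GRing.Theory Num.Theory.
Import numFieldNormedType.Exports.

Local Open Scope classical_set_scope.
Local Open Scope ring_scope.

(* [cdf X] takes values in [\bar R]; the real-valued version is what
   [lebesgue_stieltjes_measure] expects. *)
Definition rcdf d (T : measurableType d) (R : realType) (P : probability T R)
  (X : {RV P >-> R}) (r : R) : R := fine (cdf X r).

Section rcdf_cumulative.
Context d (T : measurableType d) (R : realType) (P : probability T R).
Variable X : {RV P >-> R}.

Let rcdf_nd : nondecreasing (rcdf X).
Proof.
by move=> r s rs; rewrite /rcdf fine_le ?fin_num_measure// cdf_nondecreasing.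
Qed.

Let rcdf_rc : right_continuous (rcdf X).
Proof.
move=> a; apply: fine_cvg.
by rewrite fineK ?fin_num_measure//; exact: cdf_right_continuous.
Qed.

HB.instance Definition _ :=
  isCumulative.Build R _ R (rcdf X) rcdf_nd rcdf_rc.

End rcdf_cumulative.

Definition joint_cdf d (T : measurableType d) (R : realType)
    (P : probability T R) (n : nat) (X : {RV P >-> n.-tuple R})
    (x : n.-tuple R) : \bar R :=
  P [set w | forall j : 'I_n, tnth (X w) j <= tnth x j].

(* A random vector in {0,1}^n is a random vector in R^n whose coordinates only
   take the values 0 and 1, so that the orders below apply to it directly;
   points of {0,1}^n at which its mass function is evaluated are n-tuples of
   booleans. *)
Definition binary_vector d (T : measurableType d) (R : realType)
    (P : probability T R) (n : nat) (I : {RV P >-> n.-tuple R}) : Prop :=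
  forall (w : T) (j : 'I_n), tnth (I w) j = 0 \/ tnth (I w) j = 1.

Definition binary_pmf d (T : measurableType d) (R : realType)
    (P : probability T R) (n : nat) (I : {RV P >-> n.-tuple R})
    (i : n.-tuple bool) : R :=
  fine (P [set w | forall j : 'I_n, tnth (I w) j = (tnth i j)%:R]).

Definition bernoulli_mixture d (T : measurableType d) d' (T' : measurableType d')
    (R : realType) (P : probability T R) (P' : probability T' R)
    (n : nat) (I : {RV P >-> n.-tuple R}) (L : {RV P' >-> R}) : Prop :=
  forall i : n.-tuple bool,
    let s := (\sum_(j < n) tnth i j)%N in
    (binary_pmf I i)%:E =
    (\int[lebesgue_stieltjes_measure (rcdf L)]_(l in `[0%R, 1%R])
       (l ^+ s * (1 - l) ^+ (n - s))%:E)%E.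

Definition fgm_copula (R : realType) (n : nat) (f : n.-tuple bool -> R)
    (u : n.-tuple R) : R :=
  \sum_(i : n.-tuple bool)
    f i * \prod_(m < n) (tnth u m * (1 + (-1) ^+ tnth i m * (1 - tnth u m))).

(* The joint distribution function of U agrees with the copula on [0,1]^n; this
   determines the law of U. *)
Definition has_fgm_copula d (T : measurableType d) d' (T' : measurableType d')
    (R : realType) (P : probability T R) (P' : probability T' R)
    (n : nat) (U : {RV P >-> n.-tuple R}) (I : {RV P' >-> n.-tuple R}) : Prop :=
  forall u : n.-tuple R, (forall j : 'I_n, 0 <= tnth u j <= 1) ->
    joint_cdf U u = (fgm_copula (binary_pmf I) u)%:E.

(* "The expectation exists" is read as integrability, here and below. *)
Definition cx_le d (T : measurableType d) d' (T' : measurableType d')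
    (R : realType) (P : probability T R) (P' : probability T' R)
    (X : {RV P >-> R}) (X' : {RV P' >-> R}) : Prop :=
  [/\ P.-integrable setT (EFin \o X), P'.-integrable setT (EFin \o X') &
    forall phi : R -> R, convex_function (E := R^o) setT phi ->
      P.-integrable setT (EFin \o (phi \o X)) ->
      P'.-integrable setT (EFin \o (phi \o X')) ->
      ('E_P[phi \o X] <= 'E_P'[phi \o X'])%E].

Definition shift_coord (R : realType) (n : nat) (x : n.-tuple R) (i : 'I_n)
    (e : R) : n.-tuple R :=
  [tuple (if k == i then tnth x k + e else tnth x k) | k < n].

Definition supermodular (R : realType) (n : nat) (phi : n.-tuple R -> R) : Prop :=
  forall (x : n.-tuple R) (i j : 'I_n) (e dl : R),
    (i < j)%N -> 0 < e -> 0 < dl ->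
    phi (shift_coord (shift_coord x i e) j dl) - phi (shift_coord x i e) >=
    phi (shift_coord x j dl) - phi x.

(* Unlike convex functions, supermodular functions need not be Borel; without
   Borel measurability of phi, the expectation of phi(X) is not determined by
   the law of X (a sum of arbitrary functions of one coordinate is
   supermodular). *)
Definition sm_le d (T : measurableType d) d' (T' : measurableType d')
    (R : realType) (P : probability T R) (P' : probability T' R) (n : nat)
    (X : {RV P >-> n.-tuple R}) (X' : {RV P' >-> n.-tuple R}) : Prop :=
  forall phi : n.-tuple R -> R, supermodular phi -> measurable_fun setT phi ->
    P.-integrable setT (EFin \o (phi \o X)) ->
    P'.-integrable setT (EFin \o (phi \o X')) ->
    ('E_P[phi \o X] <= 'E_P'[phi \o X'])%E.

(* Main.v *)
(* Write [B h] for the restriction to the diagonal of the multilinear extension of a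
   function [h] on {0,1}^n.  For a Bernoulli mixture, [E h(I) = E (B h)(Lambda)], and
   [B h] is convex on [0,1] when [h] is supermodular, so the convex order on the
   mixing variables gives the supermodular order on the Bernoulli vectors.
   For the copulas, let [V_j, V'_j] be independent uniform variables that are
   independent of [I]: the law of [U] is that of the vector of the
   [min(V_j, V'_j) + I_j (max(V_j, V'_j) - min(V_j, V'_j))].  Given the [V_j, V'_j],
   this is a coordinatewise nondecreasing affine function of [I], which preserves
   supermodularity, and the first part applies under the integral. *)
Require Import Defs.
From HB Require Import structures.
From mathcomp Require Import all_boot all_order all_algebra.
From mathcomp Require Import all_classical all_reals all_analysis.
From mathcomp Require Import measurable_realfun.
From mathcomp Require Import ring lra zify.

Set Implicit Arguments.
Unset Strict Implicit.
Unset Printing Implicit Defensive.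

Import Order.TTheory GRing.Theory Num.Theory.
Import numFieldNormedType.Exports.

Local Open Scope classical_set_scope.
Local Open Scope ring_scope.

(** * Multilinear extensions on the diagonal and their convexity *)

Section bernstein.
Variable R : realFieldType.
Implicit Types (h : seq bool -> R) (x y : R).

(** Points of {0,1}^n are lists of length [n], split around the bits that change, so that this
    condition and the next pass to [h \o cons b] by prepending [b] to [s]. *)
Definition cube_increasing (n : nat) h := forall s t : seq bool,
  (size s + size t).+1 = n -> h (s ++ false :: t) <= h (s ++ true :: t).

Definition cube_supermodular (n : nat) h := forall s t u : seq bool,
  (size s + size t + size u).+2 = n ->
  h (s ++ true :: t ++ false :: u) + h (s ++ false :: t ++ true :: u) <=
  h (s ++ true :: t ++ true :: u) + h (s ++ false :: t ++ false :: u).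

(* The diagonal of the multilinear extension of [h], as [bernstein_sum] shows. *)
Fixpoint bernstein (n : nat) h x : R :=
  if n is m.+1 then
    (1 - x) * bernstein m (h \o cons false) x + x * bernstein m (h \o cons true) x
  else h [::].

(** The derivative of [bernstein n h], by the product rule along the recursion. *)
Fixpoint dbernstein (n : nat) h x : R :=
  if n is m.+1 then
    bernstein m (h \o cons true) x - bernstein m (h \o cons false) x +
    ((1 - x) * dbernstein m (h \o cons false) x + x * dbernstein m (h \o cons true) x)
  else 0.

Lemma bernstein_sum n h x : bernstein n h x =
  \sum_(i : n.-tuple bool)
    x ^+ (\sum_(j < n) tnth i j) * (1 - x) ^+ (n - \sum_(j < n) tnth i j) * h i.
Proof.
elim: n h => [|n IH] h /=.
  rewrite (bigD1 [tuple])//= big_ord0 !expr0 !mul1r big1 ?addr0// => i.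
  by rewrite tuple0.
pose c (p : bool * n.-tuple bool) : n.+1.-tuple bool := [tuple of p.1 :: p.2].
have cbij : {on predT, bijective c}.
  exists (fun i => (thead i, [tuple of behead i])).
    by move=> [b t] _; rewrite /c/= theadE; congr pair; apply: val_inj.
  by move=> t _; rewrite /c/= [RHS]tuple_eta.
have sumc b t : (\sum_(j < n.+1) tnth (c (b, t)) j = b + \sum_(j < n) tnth t j)%N.
  rewrite big_ord_recl; congr (_ + _)%N.
  by apply: eq_bigr => j _; rewrite (tnth_nth false) [in RHS](tnth_nth false).
pose F (b : bool) (t : n.-tuple bool) := x ^+ (b + \sum_(j < n) tnth t j) *
  (1 - x) ^+ (n.+1 - (b + \sum_(j < n) tnth t j)) * h (b :: t).
rewrite (reindex c)// (eq_bigr (fun p => F p.1 p.2)); last by case=> b t _; rewrite sumc.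
rewrite -(pair_bigA _ F) /F /=.
rewrite big_bool addrC !IH !mulr_sumr; congr (_ + _); apply: eq_bigr => t _.
  rewrite add1n subSS exprS.
  by rewrite -!mulrA.
(* The exponent is a truncated subtraction, so the number of ones has to be bounded by [n]. *)
rewrite add0n subSn; last first.
  rewrite -[leqRHS](card_ord n) -sum1_card; apply: leq_sum => j _.
  by case: (tnth _ _).
by rewrite exprS /= -!mulrA mulrCA.
Qed.

Lemma bernsteinB n h k x :
  bernstein n (fun s => h s - k s) x = bernstein n h x - bernstein n k x.
Proof.
elim: n h k => //= n IH h k; rewrite (IH (h \o _) (k \o _)).
by rewrite (IH (h \o cons true) (k \o _)); ring.
Qed.

Lemma dbernsteinB n h k x :
  dbernstein n (fun s => h s - k s) x = dbernstein n h x - dbernstein n k x.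
Proof.
elim: n h k => [|n IH] h k /=; first by rewrite subr0.
rewrite (IH (h \o _) (k \o _)) (IH (h \o cons true) (k \o _)).
rewrite (bernsteinB n (h \o _) (k \o _)).
by rewrite (bernsteinB n (h \o cons false) (k \o _)); ring.
Qed.

Lemma bernstein_ge0 n h x : 0 <= x <= 1 ->
  (forall s, size s = n -> 0 <= h s) -> 0 <= bernstein n h x.
Proof.
move=> x01; elim: n h => [|n IH] h h0 /=; first exact: h0.
have B0 b : 0 <= bernstein n (h \o cons b) x.
  by apply: IH => s sn; apply: h0; rewrite /= sn.
by apply: addr_ge0; apply: mulr_ge0 => //; lra.
Qed.

(** The derivative is the extension of the difference between the two faces, nonnegative by
    monotonicity, plus a convex combination of the derivatives on the faces. *)
Lemma dbernstein_ge0 n h x : 0 <= x <= 1 ->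
  cube_increasing n h -> 0 <= dbernstein n h x.
Proof.
move=> x01; elim: n h => [//|n IH] h hi /=.
have D0 b : 0 <= dbernstein n (h \o cons b) x.
  by apply: IH => s t st; apply: (hi (b :: s)); rewrite /= addSn st.
apply: addr_ge0.
  rewrite -bernsteinB bernstein_ge0// => s sn.
  by rewrite subr_ge0 (hi [::])//= sn.
by apply: addr_ge0; apply: mulr_ge0 => //; lra.
Qed.

(* If [D b] denotes the gap between the two sides for [h \o cons b], then the gap
   for [h] is [(1 - y) D false + y D true] plus [(y - x)^2] times the derivative
   at [x] of the extension of the increasing map [h \o cons true - h \o cons false]. *)
Lemma bernstein_tangent n h x y : 0 <= x <= 1 -> 0 <= y <= 1 ->
  cube_supermodular n h ->
  bernstein n h x + dbernstein n h x * (y - x) <= bernstein n h y.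
Proof.
move=> x01 y01; elim: n h => [|n IH] h hsm /=; first by rewrite mul0r addr0.
have T b : bernstein n (h \o cons b) x + dbernstein n (h \o cons b) x * (y - x) <=
    bernstein n (h \o cons b) y.
  by apply: IH => s t u stu; apply: (hsm (b :: s)); rewrite /= !addSn stu.
(* Supermodularity in the first coordinate and any other one says that
   [h \o cons true - h \o cons false] is increasing. *)
have : 0 <= dbernstein n (h \o cons true) x - dbernstein n (h \o cons false) x.
  rewrite -dbernsteinB dbernstein_ge0// => s t st.
  have := hsm [::] s t; rewrite /= add0n st => /(_ erefl); lra.
move: (T false) (T true); set bf := bernstein _ _ x; set bt := bernstein _ _ x.
set df := dbernstein _ _ _; set dt := dbernstein _ _ _.
set cf := bernstein _ _ _; set ct := bernstein _ _ _ => Tf Tt d0.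
rewrite -subr_ge0.
rewrite [leRHS](_ : _ = (1 - y) * (cf - (bf + df * (y - x))) +
  (y * (ct - (bt + dt * (y - x))) + (y - x) ^+ 2 * (dt - df))); last by ring.
apply: addr_ge0; first by apply: mulr_ge0; rewrite subr_ge0//; lra.
apply: addr_ge0; first by apply: mulr_ge0; rewrite ?subr_ge0//; lra.
by rewrite mulr_ge0// sqr_ge0.
Qed.

End bernstein.

(* Beyond [0, 1], the function is continued by its tangents at the end points. *)
Lemma convex_extension01 (R : realType) (f df : R -> R) :
  (forall x y, 0 <= x <= 1 -> 0 <= y <= 1 -> f x + df x * (y - x) <= f y) ->
  exists2 g : R -> R, convex_function (E := R^o) setT g &
    forall x, 0 <= x <= 1 -> g x = f x.
Proof.
move=> tan; pose c x : R := Num.max 0 (Num.min 1 x).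
have c01 x : 0 <= c x <= 1.
  by rewrite /c le_max lexx ge_max ler01 ge_min lexx.
have cid x : 0 <= x <= 1 -> c x = x.
  by move=> /andP[x0 x1]; rewrite /c min_r// max_r.
pose g x := f (c x) + df (c x) * (x - c x).
have gtan x y : g x + df (c x) * (y - x) <= g y.
  have cx := c01 x; have cy := c01 y.
  have xy := tan _ _ cx cy; have yx := tan _ _ cy cx.
  (* The gap for [g] is that of [xy] plus this product. Adding [xy] and [yx] shows that [df] is
     monotone between [c x] and [c y], which gives the sign of the product when [y] is outside
     [0, 1]. *)
  have : 0 <= (df (c y) - df (c x)) * (y - c y); last by rewrite /g; nra.
  have mono : 0 <= (df (c y) - df (c x)) * (c y - c x) by nra.
  have [y0|y0] := ltP y 0.
    have cyE : c y = 0 by rewrite /c min_r ?max_l//; lra.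
    rewrite cyE in mono *; have [->|cx0] := eqVneq (c x) 0; last by nra.
    by rewrite subrr mul0r.
  have [y1|y1] := ltP 1 y; last by rewrite cid ?subrr ?mulr0//; lra.
  have cyE : c y = 1 by rewrite /c min_l ?max_r//; lra.
  rewrite cyE in mono *; have [->|cx0] := eqVneq (c x) 1; last by nra.
  by rewrite subrr mul0r.
exists g => [t x y _ _|x x01]; last by rewrite /g cid// subrr mulr0 addr0.
rewrite [in X in _ <= X]convRE; set z : R := (X in g X <= _).
have zE : z = t%:num * x + (1 - t%:num) * y by [].
have p0 : 0 <= t%:num :> R by [].
have p1 : t%:num <= 1 :> R by [].
(* The tangent at [z] lies below [g] at both [x] and [y]; averaging cancels the slope term. *)
move: (gtan z x) (gtan z y) => tx ty.
have : t%:num * (g z + df (c z) * (x - z)) + (1 - t%:num) * (g z + df (c z) * (y - z)) <=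
  t%:num * g x + (1 - t%:num) * g y by apply: lerD; apply: ler_wpM2l => //; rewrite subr_ge0.
apply: le_trans; rewrite le_eqVlt; apply/orP; left; apply/eqP.
transitivity (g z + df (c z) * (t%:num * x + (1 - t%:num) * y - z)); last by ring.
by rewrite -zE subrr mulr0 addr0.
Qed.

(** * Expectations of binary vectors and Bernoulli mixtures *)

Definition bool_vector (R : nzRingType) (n : nat) (s : seq bool) : n.-tuple R :=
  [tuple (nth false s j)%:R | j < n].

(** Turning a bit from [false] to [true] shifts its coordinate by 1, so this is supermodularity with
    both increments equal to 1. *)
Lemma supermodular_bool_vector (R : realType) n (phi : n.-tuple R -> R) :
  supermodular phi -> cube_supermodular n (phi \o @bool_vector R n).
Proof.
move=> sm s t u stu /=.
have hi : (size s < n)%N by rewrite -stu; lia.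
have hj : (size s + (size t).+1 < n)%N by rewrite -stu; lia.
pose i := Ordinal hi; pose j := Ordinal hj.
pose v a b := bool_vector R n (s ++ a :: t ++ b :: u).
have vi b : shift_coord (v false b) i 1 = v true b.
  apply: eq_from_tnth => k; rewrite !tnth_mktuple !nth_cat -val_eqE /=.
  case: ltngtP => // ks; last by rewrite -ks subnn/= add0r.
  by rewrite -(subnSK ks).
have vj a : shift_coord (v a false) j 1 = v a true.
  apply: eq_from_tnth => k; rewrite !tnth_mktuple !nth_cat -val_eqE /=.
  have [->|kE] := eqVneq (k : nat) (size s + (size t).+1)%N.
    by rewrite ltnNge leq_addr /= addKn /= !nth_cat ltnn subnn/= add0r.
  case: ifP => // ks.
  case E : (k - size s)%N => [//|m] /=; rewrite !nth_cat; case: ifP => // mt.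
  case F : (m - size t)%N => [|//]; move: kE; lia.
have ij : (i < j)%N by rewrite /= addnS ltnS leq_addr.
have := sm (v false false) i j 1 1 ij ltr01 ltr01.
rewrite vi !vj -/(v true false) -/(v false true) -/(v false false) -/(v true true).
lra.
Qed.

(** The Lebesgue-Stieltjes measure of the distribution function is the law of [X], since the two
    agree on the intervals []a, b]]; the formula is then a change of variables along [X]. *)
Lemma ge0_integral_lebesgue_stieltjes_rcdf d (T : measurableType d) (R : realType)
    (P : probability T R) (X : {RV P >-> R}) (D : set R)
    (f : R -> \bar R) :
  measurable D -> measurable_fun D f -> {in D, forall x, 0 <= f x}%E ->
  (\int[lebesgue_stieltjes_measure (rcdf X)]_(x in D) f x =
   \int[P]_(w in X @^-1` D) f (X w))%E.
Proof.
move=> mD mf f0; pose Y : T -> measurableTypeR R := X.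
have mY : measurable_fun setT Y by exact: measurable_funP X.
pose Y' : {mfun T >-> measurableTypeR R} := HB.pack Y (isMeasurableFun.Build _ _ _ _ Y mY).
rewrite (eq_measure_integral (distribution P Y')) => [|A mA _].
  by rewrite ge0_integral_pushforward.
apply: lebesgue_stieltjes_measure_unique => // I [[a b]]/= _ <-.
rewrite /lebesgue_stieltjes_measure /measure_extension/=.
rewrite measurable_mu_extE/=; last exact: is_ocitv.
have [ab | ba] := leP a b; last first.
  by rewrite set_itv_ge ?wlength0 ?measure0// bnd_simp -leNgt ltW.
rewrite wlength_itv_bnd// EFinB !fineK ?fin_num_measure//.
have : `]a, b]%classic = `]-oo, b] `\` `]-oo, a] => [|->].
  by rewrite -[RHS]setCK setCD setCitvl setUC -[LHS]setCK setCitv.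
rewrite measureD ?setIidr//; first exact: subset_itvl.
by rewrite -ge0_fin_numE// fin_num_measure.
Qed.

Section binary.
Context d (T : measurableType d) (R : realType) (P : probability T R) (n : nat).
Variable X : {RV P >-> n.-tuple R}.
Hypothesis Xbin : binary_vector X.

Let event (i : n.-tuple bool) := [set w | forall j, tnth (X w) j = (tnth i j)%:R].

Let measurable_event i : measurable (event i).
Proof.
have -> : event i = \bigcap_(j in [set: 'I_n])
    ((fun w => tnth (X w) j) @^-1` [set (tnth i j)%:R]).
  by apply/seteqP; split=> w wi => [j _|j]; exact: wi.
apply: fin_bigcap_measurable => // j _; rewrite -[X in measurable X]setTI.
have := (measurable_fun_tnthP X).1 (measurable_funP X) j; apply => //.
Qed.

(** [X] takes finitely many values, so [g \o X] is a simple function for an arbitrary [g]. *)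
Lemma binary_comp_sum (g : n.-tuple R -> R) : g \o X =
  (fun w => \sum_(i : n.-tuple bool) g (bool_vector R n i) * \1_(event i) w).
Proof.
apply/funext => w /=.
pose i0 : n.-tuple bool := [tuple tnth (X w) j == 1 | j < n].
have Xi0 : X w = bool_vector R n i0.
  apply: eq_from_tnth => j; rewrite tnth_mktuple -tnth_nth tnth_mktuple.
  by case: (Xbin w j) => ->; rewrite ?eqxx// eq_sym oner_eq0.
rewrite (bigD1 i0)//= indicE mem_set ?mulr1 -?Xi0; last first.
  by move=> j; rewrite Xi0 tnth_mktuple -tnth_nth.
rewrite big1 ?addr0// => i ii0; rewrite indicE memNset ?mulr0// => /= iw.
move/eqP: ii0; apply; apply: eq_from_tnth => j; rewrite tnth_mktuple iw.
by case: (tnth _ _); rewrite ?eqxx// eq_sym oner_eq0.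
Qed.

Let integrable_event (c : R) i : P.-integrable setT (fun w => (c * \1_(event i) w)%:E).
Proof.
under eq_fun do rewrite EFinM.
by apply: integrableZl => //; exact: integrable_indic.
Qed.

Lemma expectation_binary (g : n.-tuple R -> R) : ('E_P[g \o X] =
  (\sum_(i : n.-tuple bool) binary_pmf X i * g (bool_vector R n i))%:E)%E.
Proof.
rewrite unlock binary_comp_sum.
under eq_integral do rewrite -sumEFin.
rewrite integral_sum//= -sumEFin; apply: eq_bigr => i _.
under eq_integral do rewrite EFinM.
rewrite integralZl//; last exact: integrable_indic.
rewrite integral_indic// setIT [RHS]EFinM muleC /binary_pmf fineK//.
by apply: fin_num_measure; exact: measurable_event.
Qed.

End binary.

(** Each mass is the expectation of [p i \o L], where [p i] is bounded by 1 on [0, 1]; summing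
    against the values of [g] gives the formula of [bernstein_sum]. *)
Lemma expectation_bernoulli_mixture dL dI (TL : measurableType dL)
    (TI : measurableType dI) (R : realType) (PL : probability TL R)
    (PI : probability TI R) n (I : {RV PI >-> n.-tuple R}) (L : {RV PL >-> R}) :
  binary_vector I -> (forall w, 0 <= L w <= 1) -> bernoulli_mixture I L ->
  forall g : n.-tuple R -> R,
  PL.-integrable setT (EFin \o (bernstein n (g \o bool_vector R n) \o L)) /\
  ('E_PI[g \o I] = 'E_PL[bernstein n (g \o bool_vector R n) \o L])%E.
Proof.
move=> Ib L01 mix g.
pose s (i : n.-tuple bool) := (\sum_(j < n) tnth i j)%N.
pose p i (l : R) := l ^+ s i * (1 - l) ^+ (n - s i).
have mp i : measurable_fun setT (p i).
  by apply: measurable_funM; apply: measurable_funX => //; exact: measurable_funB.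
have p01 i l : 0 <= l <= 1 -> 0 <= p i l <= 1.
  move=> /andP[l0 l1]; rewrite /p mulr_ge0 ?exprn_ge0 ?subr_ge0//=.
  by rewrite mulr_ile1 ?exprn_ge0 ?exprn_ile1 ?subr_ge0// gerBl.
have ip i : PL.-integrable setT (EFin \o (p i \o L)).
  apply: measurable_bounded_integrable => //.
  - by rewrite -ge0_fin_numE// fin_num_measure.
  - exact: measurableT_comp.
  - rewrite /bounded_near; near=> M => w _; case/andP: (p01 i _ (L01 w)) => p0 p1.
    rewrite /= ger0_norm//; apply: (le_trans p1); near: M; exact: nbhs_pinfty_ge.
have pmfE i : (binary_pmf I i)%:E = (\int[PL]_w (p i (L w))%:E)%E.
  rewrite mix ge0_integral_lebesgue_stieltjes_rcdf.
  - have -> : L @^-1` `[0%R, 1%R] = setT.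
      by apply/seteqP; split => // w _; rewrite /= in_itv/=; exact: L01.
    by [].
  - exact: measurable_itv.
  - by apply/measurable_EFinP; apply: measurable_funTS; exact: (mp i).
  - move=> x; rewrite inE/= in_itv/= => x01.
    by rewrite lee_fin; case/andP: (p01 i x x01).
have BE w : (bernstein n (g \o bool_vector R n) (L w))%:E =
    (\sum_(i : n.-tuple bool) (g (bool_vector R n i))%:E * (p i (L w))%:E)%E.
  rewrite bernstein_sum -sumEFin; apply: eq_bigr => i _.
  by rewrite [RHS]muleC -EFinM.
have igp (i : n.-tuple bool) :
  PL.-integrable setT (fun w => (g (bool_vector R n i))%:E * (p i (L w))%:E)%E.
  by apply: integrableZl => //; exact: ip.
split.
  by rewrite [X in PL.-integrable _ X](funext BE); exact: integrable_sum.
rewrite expectation_binary// expectation.unlock /=.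
under [RHS]eq_integral do rewrite BE.
rewrite integral_sum// -sumEFin; apply: eq_bigr => i _.
by rewrite integralZl//= ?EFinM ?pmfE 1?muleC//; exact: ip.
Unshelve. all: by end_near. Qed.

Lemma bernoulli_mixture_supermodular dL dL' dI dI'
    (TL : measurableType dL) (TL' : measurableType dL')
    (TI : measurableType dI) (TI' : measurableType dI') (R : realType)
    (PL : probability TL R) (PL' : probability TL' R)
    (PI : probability TI R) (PI' : probability TI' R) n
    (L : {RV PL >-> R}) (L' : {RV PL' >-> R})
    (I : {RV PI >-> n.-tuple R}) (I' : {RV PI' >-> n.-tuple R}) :
  (forall w, 0 <= L w <= 1) -> (forall w, 0 <= L' w <= 1) ->
  binary_vector I -> binary_vector I' ->
  bernoulli_mixture I L -> bernoulli_mixture I' L' -> cx_le L L' ->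
  forall phi : n.-tuple R -> R, supermodular phi ->
  ('E_PI[phi \o I] <= 'E_PI'[phi \o I'])%E.
Proof.
move=> L01 L'01 Ib I'b mI mI' [_ _ LL'] phi sm.
have [iL ->] := expectation_bernoulli_mixture Ib L01 mI phi.
have [iL' ->] := expectation_bernoulli_mixture I'b L'01 mI' phi.
set h := phi \o _ in iL iL' *.
(* [cx_le] tests functions convex on the whole line, hence the extension [g], which agrees with the
   original where [L] and [L'] take their values. *)
have [g cg gE] := convex_extension01 (fun x y x01 y01 =>
  bernstein_tangent x01 y01 (supermodular_bool_vector sm)).
have gL : bernstein n h \o L = g \o L by apply/funext => w /=; rewrite gE.
have gL' : bernstein n h \o L' = g \o L' by apply/funext => w /=; rewrite gE.
by rewrite gL gL' in iL iL' *; exact: LL'.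
Qed.

(** * Probability laws determined by their distribution functions *)

Section lower_box.
Variables (R : realType) (n : nat).

Definition lower_box (u : n.-tuple R) : set (n.-tuple R) :=
  [set x | forall j, tnth x j <= tnth u j].

Lemma measurable_lower_box u : measurable (lower_box u).
Proof.
have -> : lower_box u = \bigcap_(j in [set: 'I_n])
    ((fun x => tnth x j) @^-1` `]-oo, tnth u j]).
  apply/seteqP; split=> x xu => [j _|j]; first by rewrite /= in_itv/=; exact: xu.
  by have := xu j Logic.I; rewrite /= in_itv.
apply: fin_bigcap_measurable => // j _; rewrite -[X in measurable X]setTI.
by apply: measurable_tnth => //; exact: measurable_itv.
Qed.

Lemma lower_boxI u v : lower_box u `&` lower_box v =
  lower_box [tuple Num.min (tnth u j) (tnth v j) | j < n].
Proof.
apply/seteqP; split=> x.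
  by move=> [xu xv] j; rewrite tnth_mktuple le_min xu xv.
by move=> xuv; split=> j; have := xuv j; rewrite tnth_mktuple le_min => /andP[].
Qed.

Let cube (k : nat) : n.-tuple R := [tuple k%:R | j < n].

Let bigcup_cube : \bigcup_k lower_box (cube k) = setT.
Proof.
apply/seteqP; split=> // x _.
exists (\max_(j < n) (Num.truncn `|tnth x j|).+1)%N => // j.
rewrite tnth_mktuple (le_trans (ler_norm _))// (le_trans (ltW (truncnS_gt _)))//.
by rewrite ler_nat; exact: (@leq_bigmax _ (fun j => (Num.truncn `|tnth x j|).+1)).
Qed.

(** Coordinates are measurable for the sigma-algebra generated by the boxes: the half-space where
    coordinate [j] is at most [r] is the union over [k] of the boxes with bound [r] in direction [j]
    and [k] in the others. *)
Lemma measurable_tuple_lower_box :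
  @measurable _ (n.-tuple R) = <<s range lower_box >>.
Proof.
apply/seteqP; split; last first.
  apply: smallest_sub; first exact: sigma_algebra_measurable.
  by move=> _ [u _ <-]; exact: measurable_lower_box.
pose S := g_sigma_algebraType (range lower_box).
have coord j : measurable_fun setT (fun x : S => tnth (x : n.-tuple R) j).
  move=> mS; apply: (measurability _ (RGenOInfty.measurableE R)) => //.
  move=> /= _ [_ [r ->] <-]; rewrite setTI.
  have -> : (fun x : S => tnth x j) @^-1` `]r, +oo[ = ~` \bigcup_k lower_box
      [tuple if i == j then r else k%:R | i < n].
    rewrite preimage_itvoy; apply/seteqP; split=> x /=.
      move=> rx [k _ /(_ j)]; rewrite tnth_mktuple eqxx; lra.
    move=> xr; rewrite ltNge; apply/negP => xjr; apply: xr.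
    have : (\bigcup_k lower_box (cube k)) x by rewrite bigcup_cube.
    move=> [k _ xk]; exists k => // i; rewrite tnth_mktuple.
    by case: eqP => [->//|_]; have := xk i; rewrite tnth_mktuple.
  apply: measurableC; apply: bigcupT_measurable => k.
  by apply: sub_sigma_algebra; eexists.
have mid : measurable_fun setT (fun x : S => x : n.-tuple R).
  by apply/measurable_fun_tnthP.
by move=> A mA; have := mid measurableT A mA; rewrite setTI preimage_id.
Qed.

(** The boxes form a generating pi-system and the boxes at (k, ..., k) exhaust the space. *)
Lemma eq_probability_lower_box (P Q : probability (n.-tuple R) R) :
  (forall u, P (lower_box u) = Q (lower_box u)) ->
  forall A, measurable A -> P A = Q A.
Proof.
move=> PQ A mA.
apply: (measure_unique (range lower_box) (fun k => lower_box (cube k))) => //.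
- exact: measurable_tuple_lower_box.
- by move=> _ _ [u _ <-] [v _ <-]; rewrite lower_boxI; eexists.
- by move=> _ [u _ <-]; exact: PQ.
- by move=> k; rewrite -ge0_fin_numE// fin_num_measure//; exact: measurable_lower_box.
Qed.

(* A law on the unit cube whose distribution function vanishes on the lower faces
   is determined by the values of that function on the cube. *)
Lemma eq_probability_unit_box (P Q : probability (n.-tuple R) R) :
  (forall u, (forall j, 0 <= tnth u j <= 1) -> P (lower_box u) = Q (lower_box u)) ->
  P (lower_box (cube 1)) = 1%E ->
  (forall u j, (forall j, 0 <= tnth u j <= 1) -> tnth u j = 0 -> P (lower_box u) = 0%E) ->
  forall A, measurable A -> P A = Q A.
Proof.
move=> PQ P1 P0; apply: eq_probability_lower_box => u.
have c01 j : 0 <= tnth (cube 1) j <= 1 by rewrite tnth_mktuple ler01 lexx.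
have Q1 : Q (lower_box (cube 1)) = 1%E by rewrite -PQ.
(* A law carried by the box at (1, ..., 1) sees only what lies in that box, so the bounds can be
   capped at 1. *)
have capE (M : probability (n.-tuple R) R) : M (lower_box (cube 1)) = 1%E ->
    M (lower_box u) = M (lower_box u `&` lower_box (cube 1)).
  move=> M1; have mu := measurable_lower_box u.
  have mc := measurable_lower_box (cube 1).
  rewrite -[in LHS](setIT (lower_box u)) -(setUv (lower_box (cube 1))) setIUr.
  have MC0 : M (~` lower_box (cube 1)) = 0%E by rewrite probability_setC// M1 subee.
  rewrite measureU //; last 3 first.
  - exact: measurableI.
  - by apply: measurableI => //; exact: measurableC.
  - by rewrite -setIIr setICr setI0.
  rewrite [X in (_ + X)%E](_ : _ = 0%E) ?adde0//.
  apply/eqP; rewrite -measure_le0 -MC0 le_measure ?inE//; last exact: measurableC.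
  by apply: measurableI => //; exact: measurableC.
rewrite (capE P)// (capE Q)// lower_boxI.
set v := [tuple _ | _ < _].
have [v0|/existsNP[j vj]] := pselect (forall j, 0 <= tnth v j).
  by apply: PQ => j; rewrite v0 /v !tnth_mktuple ge_min lexx orbT.
(* When coordinate [j] of [v] is negative, the box of [v] lies in that of [f], a point of a lower
   face, which is null by [P0]. *)
pose f := [tuple (if i == j then 0 else 1) : R | i < n].
have f01 i : 0 <= tnth f i <= 1 by rewrite tnth_mktuple; case: ifP; rewrite ?lexx ler01.
have vf : lower_box v `<=` lower_box f.
  move=> x xv i; rewrite tnth_mktuple; case: eqP => [->|_].
    by rewrite (le_trans (xv j))//; move/negP: vj; rewrite -ltNge => /ltW.
  by rewrite (le_trans (xv i))// /v !tnth_mktuple ge_min lexx orbT.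
have Pf : P (lower_box f) = 0%E.
  by apply: (P0 f j) => //; rewrite tnth_mktuple eqxx.
have null (M : probability (n.-tuple R) R) :
    M (lower_box f) = 0%E -> M (lower_box v) = 0%E.
  move=> Mf; apply/eqP; rewrite -measure_le0 -Mf le_measure ?inE//;
    exact: measurable_lower_box.
by rewrite !null// -PQ.
Qed.

End lower_box.

(** * Independent pairs of uniform variables and interpolation between their minimum and maximum *)

(** The power of [P] is built by pushing [P \x Q] forward along [cons], from the point mass at the
    empty tuple. *)
Lemma iid_probability d (T : measurableType d) (R : realType)
    (P : probability T R) (n : nat) :
  {Q : probability (n.-tuple T) R | forall A : 'I_n -> set T,
    (forall i, measurable (A i)) ->
    Q [set t | forall i, A i (tnth t i)] = (\prod_(i < n) P (A i))%E}.
Proof.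
elim: n => [|n [Q QE]].
  exists (dirac ([tuple] : 0.-tuple T)) => A _.
  by rewrite big_ord0 /= /dirac indicE mem_set// => -[].
pose c (p : T * n.-tuple T) : n.+1.-tuple T := [the n.+1.-tuple T of p.1 :: p.2].
have mc : measurable_fun setT c.
  by apply: measurable_cons; [exact: measurable_fst|exact: measurable_snd].
pose c' : {mfun (T * n.-tuple T)%type >-> n.+1.-tuple T} :=
  HB.pack c (isMeasurableFun.Build _ _ _ _ c mc).
exists (distribution (P \x Q)%E c') => A mA.
rewrite /distribution /pushforward /=.
have -> : c' @^-1` [set t | forall i, A i (tnth t i)] =
    A ord0 `*` [set t | forall i, A (lift ord0 i) (tnth t i)].
  apply/seteqP; split=> -[x t] /=.
    move=> h; split; first exact: (h ord0).
    by move=> i; have := h (lift ord0 i); rewrite /= /c/= tnthS.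
  move=> [x0 h] i; case: (unliftP ord0 i) => [j|] ->; last exact: x0.
  by rewrite /= /c/= tnthS.
rewrite big_ord_recl -QE// product_measure1E//.
have -> : [set t : n.-tuple T | forall i, A (lift ord0 i) (tnth t i)] =
    \bigcap_(i in [set: 'I_n]) ((fun t => tnth t i) @^-1` A (lift ord0 i)).
  by apply/seteqP; split=> t tA => [j _|j]; exact: tA.
apply: fin_bigcap_measurable => // j _; rewrite -[X in measurable X]setTI.
exact: measurable_tnth.
Qed.

Section uniform_pair.
Variable R : realType.

Let toR (x : measurableTypeR R) : R := x.

HB.instance Definition _ :=
  @isMeasurableFun.Build _ _ _ _ toR (@measurable_id _ _ setT).

(* [uniform_prob] lives on [measurableTypeR R], whose display is not that of [R]. *)
Definition uniform01 : probability R R :=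
  distribution (uniform_prob (@ltr01 R)) toR.

Lemma uniform01_itvNyc (u : R) : 0 <= u <= 1 -> uniform01 `]-oo, u]%classic = u%:E.
Proof.
move=> /andP[u0 u1]; rewrite /uniform01/= /distribution /pushforward /=.
rewrite preimage_id /uniform_prob integral_uniform_pdf.
have -> : (`]-oo, u] `&` `[0, 1] = `[0, u])%classic.
  apply/seteqP; split=> x; rewrite /= !in_itv/=.
    by case=> xu /andP[x0 _]; rewrite x0 xu.
  by move=> /andP[-> xu]; rewrite xu (le_trans xu u1).
rewrite (eq_integral (cst 1%E)).
  rewrite integral_cst//= mul1e lebesgue_measure_itv/= lte_fin.
  have [u0'|u0'] := ltP 0 u; first by rewrite oppr0 adde0.
  by congr EFin; lra.
move=> x; rewrite inE/= in_itv/= => /andP[x0 xu]; rewrite /uniform_pdf x0/=.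
by rewrite (le_trans xu u1) subr0 invr1.
Qed.

(** The minimum at [x = 0] and the maximum at [x = 1]; the affine form covers the real arguments at
    which supermodularity is tested. *)
Definition interp_min_max (x : R) (p : R * R) : R :=
  Num.min p.1 p.2 + x * (Num.max p.1 p.2 - Num.min p.1 p.2).

Lemma measurable_interp_min_max d (T : measurableType d) (f : T -> R) (g : T -> R * R) :
  measurable_fun setT f -> measurable_fun setT g ->
  measurable_fun setT (fun x => interp_min_max (f x) (g x)).
Proof.
move=> mf mg.
have m1 : measurable_fun setT (fun x => (g x).1) by exact: measurableT_comp.
have m2 : measurable_fun setT (fun x => (g x).2) by exact: measurableT_comp.
apply: measurable_funD; first exact: measurable_minr.
apply: measurable_funM => //; apply: measurable_funB.
  exact: measurable_maxr.
exact: measurable_minr.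
Qed.

(** The maximum of two independent uniform variables has distribution function [u ^+ 2], the minimum
    [1 - (1 - u) ^+ 2]; these are the two factors of the FGM copula. *)
Lemma uniform_pair_min_max (u : R) (b : bool) : 0 <= u <= 1 ->
  (uniform01 \x uniform01)%E [set p | interp_min_max b%:R p <= u] =
  (u * (1 + (-1) ^+ b * (1 - u)))%:E.
Proof.
move=> u01; have uE := uniform01_itvNyc u01.
case: b => /=.
  have -> : [set p : R * R | interp_min_max 1 p <= u] = (`]-oo, u] `*` `]-oo, u])%classic.
    apply/seteqP; split=> -[x y]; rewrite /interp_min_max /= mul1r addrC subrK !in_itv/= ge_max.
      by move/andP.
    by case=> -> ->.
  by rewrite product_measure1E//= uE -EFinM; congr EFin; ring.
have -> : [set p : R * R | interp_min_max 0 p <= u] = (~` (`]u, +oo[ `*` `]u, +oo[))%classic.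
  apply/seteqP; split=> -[x y]; rewrite /interp_min_max /= mul0r addr0 !in_itv/= !andbT ge_min.
    by move=> + [ux uy]; rewrite !leNgt ux uy.
  by move=> h; apply: contra_notP h => /negP; rewrite negb_or -!ltNge => /andP[].
rewrite probability_setC//; last exact: measurableX.
have uC : uniform01 `]u, +oo[%classic = (1 - u)%:E.
  by rewrite -setCitvl probability_setC// uE.
by rewrite /= product_measure1E//= uC -EFinM -EFinB; congr EFin; ring.
Qed.

End uniform_pair.

Definition interp_tuple (R : realType) (n : nat) (t : n.-tuple (R * R))
    (x : n.-tuple R) : n.-tuple R :=
  [tuple interp_min_max (tnth x j) (tnth t j) | j < n].

Lemma supermodular_interp_tuple (R : realType) (n : nat) (t : n.-tuple (R * R))
    (phi : n.-tuple R -> R) :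
  supermodular phi -> supermodular (phi \o interp_tuple t).
Proof.
move=> sm x i j e dl ij e0 dl0 /=.
pose w k := Num.max (tnth t k).1 (tnth t k).2 - Num.min (tnth t k).1 (tnth t k).2.
have w0 k : 0 <= w k by rewrite subr_ge0 ge_min le_max lexx.
have shiftE y k c : interp_tuple t (shift_coord y k c) =
    shift_coord (interp_tuple t y) k (c * w k).
  apply: eq_from_tnth => l; rewrite !tnth_mktuple; case: eqP => [->|//].
  by rewrite /interp_min_max mulrDl addrA.
have shift0 y k : shift_coord y k 0 = y :> n.-tuple R.
  by apply: eq_from_tnth => l; rewrite tnth_mktuple addr0 if_same.
rewrite !shiftE.
(* [supermodular] speaks of positive increments only; where a slope [w] vanishes, the shift is
   trivial and both differences agree. *)
have [->|wi] := eqVneq (w i) 0; first by rewrite mulr0 !shift0.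
have [->|wj] := eqVneq (w j) 0; first by rewrite mulr0 !shift0 !subrr.
by apply: sm => //; rewrite mulr_gt0// lt_neqAle eq_sym ?wi ?wj w0.
Qed.

(** * Representation of the law of the FGM copula *)

Section fgm_law.
Context (R : realType) (n : nat) (dI dU : measure_display)
  (TI : measurableType dI) (TU : measurableType dU)
  (PI : probability TI R) (PU : probability TU R)
  (I : {RV PI >-> n.-tuple R}) (U : {RV PU >-> n.-tuple R}).
Hypotheses (Ibin : binary_vector I) (UI : has_fgm_copula U I).

Variable Q : probability (n.-tuple (R * R)) R.
Hypothesis QE : forall A : 'I_n -> set (R * R), (forall i, measurable (A i)) ->
  Q [set t | forall i, A i (tnth t i)] =
  (\prod_(i < n) (uniform01 R \x uniform01 R) (A i))%E.

Let W (p : TI * n.-tuple (R * R)) : n.-tuple R := interp_tuple p.2 (I p.1).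

Let measurable_W : measurable_fun setT W.
Proof.
apply/measurable_fun_tnthP => j.
rewrite (_ : _ \o W = fun p : TI * n.-tuple (R * R) =>
  interp_min_max (tnth (I p.1) j) (tnth p.2 j)); last first.
  by apply/funext => p; rewrite /= tnth_mktuple.
have mI : measurable_fun setT (fun p : TI * n.-tuple (R * R) => tnth (I p.1) j).
  apply: (measurableT_comp (f := fun x => tnth (I x) j)) => //.
  exact: (measurable_fun_tnthP I).1 (measurable_funP I) j.
have mt : measurable_fun setT (fun p : TI * n.-tuple (R * R) => tnth p.2 j).
  by apply: (measurableT_comp (f := fun x => tnth x j)) => //; exact: measurable_tnth.
exact: measurable_interp_min_max.
Qed.

HB.instance Definition _ := isMeasurableFun.Build _ _ _ _ W measurable_W.

Let distribution_W u : (forall j, 0 <= tnth u j <= 1) ->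
  distribution (PI \x Q)%E W (lower_box u) = (fgm_copula (binary_pmf I) u)%:E.
Proof.
move=> u01; rewrite /distribution /pushforward /= /product_measure1 /=.
(* The sign [(-1) ^+ i] is written [1 - 2 * x], which has the same values at 0 and 1 and makes sense
   on real tuples. *)
pose g (x : n.-tuple R) := \prod_(m < n) (tnth u m * (1 + (1 - 2 * tnth x m) * (1 - tnth u m))).
have sub12 : 1 - 2 = - 1 :> R by ring.
transitivity ('E_PI[g \o I])%E.
  rewrite expectation.unlock; apply: eq_integral => w _.
  (* For fixed [I w], the event is a rectangle in the pairs, so its mass under [Q] is a product. *)
  have -> : xsection (W @^-1` lower_box u) w = [set t | forall j : 'I_n,
      [set p | interp_min_max (tnth (I w) j) p <= tnth u j] (tnth t j)].
    apply/seteqP; split=> t /=; rewrite xsectionP.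
      by move=> h j; have := h j; rewrite tnth_mktuple.
    by move=> h j; have := h j; rewrite tnth_mktuple.
  rewrite (@QE (fun j => [set p | interp_min_max (tnth (I w) j) p <= tnth u j])); last first.
    move=> j; rewrite -[X in measurable X]setTI.
    have mj : measurable_fun setT (interp_min_max (tnth (I w) j)).
      exact: (measurable_interp_min_max (f := cst _) (g := id)).
    have := mj measurableT _ (measurable_itv `]-oo, tnth u j]).
    by rewrite preimage_itvNyc.
  rewrite /g /= -prodEFin; apply: eq_bigr => j _.
  have [->|->] := Ibin w j.
    by rewrite (uniform_pair_min_max false)// expr0 mulr0 subr0.
  by rewrite (uniform_pair_min_max true)// expr1 mulr1 sub12.
rewrite expectation_binary//; congr EFin; apply: eq_bigr => i _; congr (_ * _).
apply: eq_bigr => j _; rewrite tnth_mktuple -tnth_nth.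
by case: (tnth i j); rewrite ?mulr0 ?subr0// mulr1 sub12.
Qed.

Let distribution_U A : measurable A ->
  distribution PU U A = distribution (PI \x Q)%E W A.
Proof.
move=> mA; apply/esym; apply: eq_probability_unit_box => //.
- by move=> u u01; transitivity (joint_cdf U u) => //; rewrite (UI u01); exact: distribution_W.
- have one01 j : 0 <= tnth [tuple 1%:R : R | _ < n] j <= 1.
    by rewrite tnth_mktuple ler01 lexx.
  rewrite [LHS](distribution_W one01) /fgm_copula.
  (* At (1, ..., 1) the copula is the total mass of [I], read off the expectation of the constant
     1. *)
  have := expectation_binary Ibin (cst 1); rewrite (expectation_cst PI 1) => ->.
  congr EFin; apply: eq_bigr => i _; congr (_ * _).
  by apply: big1 => j _; rewrite tnth_mktuple subrr mulr0 addr0 mulr1.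
- move=> u j u01 uj; rewrite [LHS](distribution_W u01); congr EFin.
  by apply: big1 => i _; rewrite (bigD1 j)//= uj mul0r mul0r mulr0.
Qed.

(** [U] and [W] have the same law, which carries integrability and expectation over to [W]; Fubini
    then puts the integral over the pairs outside. *)
Lemma expectation_fgm (phi : n.-tuple R -> R) :
  measurable_fun setT phi -> PU.-integrable setT (EFin \o (phi \o U)) ->
  Q.-integrable setT (fun t => 'E_PI[(phi \o interp_tuple t) \o I]%E) /\
  ('E_PU[phi \o U] = \int[Q]_t 'E_PI[(phi \o interp_tuple t) \o I])%E.
Proof.
move=> mphi iphi.
have mE : measurable_fun setT (EFin \o phi) by exact/measurable_EFinP.
have absE : measurable_fun setT (abse \o (EFin \o phi)) by exact: measurableT_comp.
have abs0 y : (0 <= (abse \o (EFin \o phi)) y)%E by exact: abse_ge0.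
have iW : (PI \x Q)%E.-integrable setT (EFin \o phi \o W).
  apply/integrableP; split; first exact: measurableT_comp.
  have /integrableP[_] := iphi; apply: le_lt_trans.
  rewrite -(ge0_integral_distribution W (f := abse \o (EFin \o phi)))//.
  rewrite -(ge0_integral_distribution U (f := abse \o (EFin \o phi)))//.
  rewrite le_eqVlt; apply/orP; left; apply/eqP.
  by apply: eq_measure_integral => A mA _; apply/esym; exact: distribution_U.
pose G := fubini_G PI (EFin \o phi \o W).
have EE t : ('E_PI[(phi \o interp_tuple t) \o I] = G t)%E.
  by rewrite expectation.unlock.
split.
  under eq_fun do rewrite EE.
  apply/integrableP; split; first exact: (measurable_fubini_G iW).
  have mW : measurable_fun setT (EFin \o phi \o W) by exact: measurableT_comp.
  have := (integrable21ltyP PI Q mW).1 iW; apply: le_lt_trans.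
  apply: ge0_le_integral => //.
  - by apply: measurableT_comp => //; exact: (measurable_fubini_G iW).
  - apply: (measurable_fun_fubini_tonelli_G (m1 := PI) (abse \o (EFin \o phi \o W))).
      exact: (measurableT_comp absE measurable_W).
    by move=> p; exact: abse_ge0.
  - by move=> t _; apply: le_abse_integral => //; exact: measurableT_comp.
under [RHS]eq_integral do rewrite EE.
rewrite integral21_prod_meas1// expectation.unlock.
rewrite -(@integral_distribution _ _ _ _ _ (PI \x Q)%E W (EFin \o phi))//.
rewrite -[LHS](@integral_distribution _ _ _ _ _ PU U (EFin \o phi))//.
by apply: eq_measure_integral => A mA _; exact: distribution_U.
Qed.

End fgm_law.

Theorem proposition5p4 (R : realType) (d : nat) (hd : (2 <= d)%N)
    (dL dL' dI dI' dU dU' : measure_display)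
    (TL : measurableType dL) (TL' : measurableType dL')
    (TI : measurableType dI) (TI' : measurableType dI')
    (TU : measurableType dU) (TU' : measurableType dU')
    (PL : probability TL R) (PL' : probability TL' R)
    (PI : probability TI R) (PI' : probability TI' R)
    (PU : probability TU R) (PU' : probability TU' R)
    (L : {RV PL >-> R}) (L' : {RV PL' >-> R})
    (hL : forall w, 0 <= L w <= 1) (hL' : forall w, 0 <= L' w <= 1)
    (EL : ('E_PL[L] = (2^-1)%:E)%E) (EL' : ('E_PL'[L'] = (2^-1)%:E)%E)
    (I : {RV PI >-> d.-tuple R}) (I' : {RV PI' >-> d.-tuple R})
    (hI : binary_vector I) (hI' : binary_vector I')
    (mI : bernoulli_mixture I L) (mI' : bernoulli_mixture I' L')
    (U : {RV PU >-> d.-tuple R}) (U' : {RV PU' >-> d.-tuple R})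
    (hU : has_fgm_copula U I) (hU' : has_fgm_copula U' I') :
  cx_le L L' -> sm_le I I' /\ sm_le U U'.
Proof.
move=> LL'.
have sm phi : supermodular phi -> ('E_PI[phi \o I] <= 'E_PI'[phi \o I'])%E.
  exact: (bernoulli_mixture_supermodular hL hL').
split=> phi sphi mphi iphi iphi'; first exact: sm.
(* The same [Q] serves both copulas, so the two outer integrals can be compared pointwise in [t]. *)
have [Q QE] := iid_probability (uniform01 R \x uniform01 R)%E d.
have [iG ->] := expectation_fgm hI hU QE mphi iphi.
have [iG' ->] := expectation_fgm hI' hU' QE mphi iphi'.
apply: le_integral => // t _; apply: sm.
exact: supermodular_interp_tuple.
Qed.
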